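(* Let $\Pi$ be the set of all nonincreasing sequences of positive numbers with first term $1$ and positive limit, that is, $$\Pi=\{\pi=(\pi_n)_{n\in\mathbb{N}}:\ \pi_1=1,\ \lim_n\pi_n>0,\ \text{and } \pi_k\ge\pi_{k+1}\text{ for each }k\in\mathbb{N}\},$$ and let $\mathbf{1}=(1,1,\dots)$ be the constant sequence. For each $\pi\in\Pi\setminus\{\mathbf{1}\}$, let $\Phi_\pi$ denote the symmetric norming function defined by $\Phi_\pi(\xi_1,\xi_2,\dots)=\sum_j\pi_j\xi_j$ for $(\xi_j)_j\in c_{00}^*$. Then: (1) for every $\pi\in\Pi\setminus\{\mathbf{1}\}$, $\Phi_\pi$ is equivalent to the maximal s.n.function $\Phi_1$; and (2) for every $\pi\in\Pi\setminus\{\mathbf{1}\}$, the identity operator $I$ on $\ell^2$ satisfies $I\notin\mathcal{N}_{\Phi_\pi^*}(\ell^2)$.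
   Context: Write $\mathcal{H}=\ell^2$ (complex, over $\mathbb{N}$). $\mathcal{B}(\mathcal{H})$ and $\mathcal{B}_1(\mathcal{H})$ denote the bounded and trace class operators on $\mathcal{H}$. For $T\in\mathcal{B}(\mathcal{H})$ and $j\ge 1$, the $j$-th singular number is $s_j(T)=\inf\{\|T-F\|: F\in\mathcal{B}(\mathcal{H}),\ \operatorname{rank}F\le j-1\}$ (for compact $T$ these are the usual singular values in nonincreasing order). $c_{00}$ is the space of finitely supported real sequences and $c_{00}^*\subseteq c_{00}$ is the cone of nonincreasing nonnegative ones. A symmetric norming function (s.n.function) is a norm $\Phi:c_{00}\to[0,\infty)$ such that $\Phi((1,0,0,\dots))=1$ and $\Phi((\xi_1,\dots,\xi_n,0,\dots))=\Phi((|\xi_{j_1}|,\dots,|\xi_{j_n}|,0,\dots))$ for every $n$ and every permutation $j_1,\dots,j_n$ of $1,\dots,n$. An s.n.function is determined by its values on $c_{00}^*$ (apply it to the nonincreasing rearrangement of $|\xi|$), and is specified by giving those values. The maximal s.n.function is $\Phi_1(\xi)=\sum_j\xi_j$ for $\xi\in c_{00}^*$. Two s.n.functions $\Phi,\Psi$ are equivalent if $\sup_{\xi\neq0}\Phi(\xi)/\Psi(\xi)<\infty$ and $\sup_{\xi\ne0}\Psi(\xi)/\Phi(\xi)<\infty$. The adjoint $\Phi^*$ of $\Phi$ is the s.n.function given by $\Phi^*(\eta)=\max\{\sum_j\eta_j\xi_j:\xi\in c_{00}^*,\ \Phi(\xi)=1\}$ for $\eta\in c_{00}^*$. Let $\Phi$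 be an s.n.function equivalent to $\Phi_1$. For $K\in\mathcal{B}_1(\mathcal{H})$ put $\|K\|_\Phi=\sup_n\Phi((s_1(K),\dots,s_n(K),0,\dots))<\infty$, and for $T\in\mathcal{B}(\mathcal{H})$ put $\|T\|_{\Phi^*}=\sup_n\Phi^*((s_1(T),\dots,s_n(T),0,\dots))<\infty$. It is known that $(\mathcal{B}(\mathcal{H}),\|\cdot\|_{\Phi^*})$ is isometrically the dual of $(\mathcal{B}_1(\mathcal{H}),\|\cdot\|_\Phi)$ via the trace pairing, so $\|T\|_{\Phi^*}=\sup\{|\operatorname{Tr}(TK)|:K\in\mathcal{B}_1(\mathcal{H}),\ \|K\|_\Phi\le1\}$. $T\in\mathcal{B}(\mathcal{H})$ is $\Phi^*$-norming, written $T\in\mathcal{N}_{\Phi^*}(\mathcal{H})$, if there is $K\in\mathcal{B}_1(\mathcal{H})$ with $\|K\|_\Phi=1$ and $|\operatorname{Tr}(TK)|=\|T\|_{\Phi^*}$. *)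

(* Defs.v *)
From HB Require Import structures.
From mathcomp Require Import all_boot all_order all_algebra.
From mathcomp Require Import complex lra.
From mathcomp Require Import all_classical all_reals all_analysis.

Set Implicit Arguments.
Unset Strict Implicit.
Unset Printing Implicit Defensive.

Import Order.TTheory GRing.Theory Num.Theory.
Import numFieldNormedType.Exports.

Local Open Scope classical_set_scope.
Local Open Scope ring_scope.

(* All sequences are indexed from 0: index j holds the (j+1)-st term. *)

Section l2_space.
Variable R : realType.

Definition modulus : R[i] -> R := @ComplexField.Normc.normc R.

Definition sqr_series (x : nat -> R[i]) : R^nat :=
  series (fun n => modulus (x n) ^+ 2).

Definition square_summable : {pred nat -> R[i]} :=
  [pred x | `[< cvgn (sqr_series x) >]].

Lemma modulus_ge0 z : 0 <= modulus z.
Proof. by case: z => a b; rewrite sqrtr_ge0. Qed.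

Lemma modulus0 : modulus 0 = 0.
Proof. exact: ComplexField.Normc.normc0. Qed.

Lemma sqr_modulusD z t :
  modulus (z + t) ^+ 2 <= 2 * modulus z ^+ 2 + 2 * modulus t ^+ 2.
Proof.
have h : modulus (z + t) <= modulus z + modulus t := le_normcD z t.
have c0 := modulus_ge0 (z + t); have a0 := modulus_ge0 z.
have b0 := modulus_ge0 t.
set c := modulus (z + t) in h c0 *; set a := modulus z in h a0 *.
set b := modulus t in h b0 *.
have : c ^+ 2 <= (a + b) ^+ 2 by rewrite lerXn2r ?nnegrE ?addr_ge0.
have := sqr_ge0 (a - b); nra.
Qed.

Lemma square_summable_submod : submod_closed square_summable.
Proof.
split.
  apply/asboolP; rewrite /sqr_series.
  rewrite (_ : series _ = (fun=> 0)); first exact: is_cvg_cst.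
  apply/funext => n; rewrite /series /= big1 // => k _.
  by rewrite -[LHS]/(modulus 0 ^+ 2) modulus0 expr0n.
move=> a x y /asboolP cx /asboolP cy; apply/asboolP.
pose ux n : R := modulus (x n) ^+ 2.
pose uy n : R := modulus (y n) ^+ 2.
pose u : R^nat := (2 * modulus a ^+ 2) *: (ux : R^nat) + 2 *: (uy : R^nat).
apply: (@series_le_cvg _ _ u).
- by move=> n; exact: sqr_ge0.
- move=> n; change (0 <= 2 * modulus a ^+ 2 * ux n + 2 * uy n).
  have x0 : 0 <= ux n by exact: sqr_ge0.
  have y0 : 0 <= uy n by exact: sqr_ge0.
  have a0 : 0 <= modulus a ^+ 2 by exact: sqr_ge0.
  by apply: addr_ge0; apply: mulr_ge0 => //; apply: mulr_ge0.
- move=> n; apply: (le_trans (sqr_modulusD _ _)).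
  change ((a *: x) n) with (a * x n).
  by rewrite /modulus ComplexField.Normc.normcM exprMn mulrA.
- by apply: is_cvg_seriesD; apply: is_cvg_seriesZ.
Qed.

HB.instance Definition _ :=
  GRing.isSubmodClosed.Build R[i] (nat -> R[i]) square_summable
    square_summable_submod.

Record l2 := L2 { l2_val :> nat -> R[i]; l2_valP : l2_val \in square_summable }.

HB.instance Definition _ := [isSub for l2_val].
HB.instance Definition _ := [Choice of l2 by <:].
HB.instance Definition _ := [SubChoice_isSubLmodule of l2 by <:].

Definition l2norm (x : l2) : R := Num.sqrt (limn (sqr_series x)).

Lemma basis_square_summable (n : nat) :
  (fun k : nat => (k == n)%:R : R[i]) \in square_summable.
Proof.
apply/asboolP; apply: (is_cvg_near_cst (modulus 1 ^+ 2)) => /=.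
exists n.+1 => // m /= nm; rewrite /sqr_series /series /=.
rewrite (bigD1_seq n) ?iota_uniq ?mem_index_iota //= eqxx big1 ?addr0 //.
by move=> k /negPf ->; rewrite -[LHS]/(modulus 0 ^+ 2) modulus0 expr0n.
Qed.

Definition l2basis (n : nat) : l2 := L2 (basis_square_summable n).

End l2_space.

Section operators.
Variable R : realType.
Local Notation H := (l2 R).

Definition bounded_op (T : H -> H) : Prop :=
  exists M : R, forall x, l2norm (T x) <= M * l2norm x.

Definition opnorm (T : H -> H) : R :=
  sup [set l2norm (T x) | x in [set x | l2norm x <= 1]].

(* the range of F is contained in the span of n vectors *)
Definition rank_le (F : H -> H) (n : nat) : Prop :=
  exists v : 'I_n -> H, forall x, exists c : 'I_n -> R[i],
    F x = \sum_i c i *: v i.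

Definition singval (T : H -> H) (j : nat) : R :=
  inf [set opnorm (fun x => T x - F x) |
        F in [set F : {linear H -> H} | bounded_op F /\ rank_le F j]].

(* Summability forces [singval K j] to tend to 0, hence K to be compact. *)
Definition trace_class (K : H -> H) : Prop :=
  bounded_op K /\ cvgn (series (singval K)).

(* \sum_n <A e_n, e_n> over the standard basis *)
Definition trace (A : H -> H) : R[i] :=
  limn (series (fun n => A (l2basis R n) n : R[i]^o)).

End operators.

(* c_00 is modelled by {poly R}: coefficient sequences of polynomials are
   exactly the finitely supported sequences, [Poly s] is s padded by zeros,
   and 1 is (1, 0, 0, ...). *)
Section snfunctions.
Variable R : realType.
Local Notation c00 := {poly R}.
Implicit Types xi eta zeta : c00.

Definition c00star (xi : c00) : Prop :=
  forall j, 0 <= xi`_j /\ xi`_j.+1 <= xi`_j.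

Record snfunction := SNFunction {
  snf_fun :> c00 -> R;
  snf_ge0 : forall xi, 0 <= snf_fun xi;
  snf_eq0 : forall xi, snf_fun xi = 0 -> xi = 0;
  snfZ : forall a xi, snf_fun (a *: xi) = `|a| * snf_fun xi;
  snfD : forall xi eta, snf_fun (xi + eta) <= snf_fun xi + snf_fun eta;
  snf1 : snf_fun 1 = 1;
  snf_sym : forall x y : seq R, perm_eq y [seq `|t| | t <- x] ->
    snf_fun (Poly x) = snf_fun (Poly y)
}.

(* nonincreasing rearrangement of |xi| *)
Definition rearr (xi : c00) : c00 :=
  Poly (sort (fun a b : R => b <= a) [seq `|t| | t <- xi]).

(* the extension to c_00, through [rearr], of xi |-> \sum_j w_j xi_j on c00star *)
Definition wsum (w : nat -> R) (xi : c00) : R :=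
  \sum_(j < size xi) w j * (rearr xi)`_j.

Definition snf_equiv (Phi Psi : snfunction) : Prop :=
  has_ubound [set Phi xi / Psi xi | xi in [set xi | xi != 0]] /\
  has_ubound [set Psi xi / Phi xi | xi in [set xi | xi != 0]].

Let geR : rel R := fun a b => b <= a.

Let geR_total : total geR. Proof. by move=> a b; exact: le_total. Qed.
Let geR_trans : transitive geR.
Proof. by move=> b a c ab bc; exact: le_trans bc ab. Qed.
Let geR_anti : antisymmetric geR.
Proof. by move=> a b /andP[ab ba]; apply: le_anti; apply/andP; split. Qed.

Fixpoint dotw (w : nat -> R) (s : seq R) : R :=
  if s is a :: s' then w 0%N * a + dotw (w \o S) s' else 0.

Lemma dotwE w s n : (size s <= n)%N -> dotw w s = \sum_(j < n) w j * s`_j.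
Proof.
elim: s w n => [|a s IH] w n.
  by move=> _; rewrite big1 // => j _; rewrite nth_nil mulr0.
case: n => // n sn /=; rewrite big_ord_recl /=; congr (_ + _).
exact: IH.
Qed.

Lemma dotw_cat0 w s k : dotw w (s ++ nseq k 0) = dotw w s.
Proof.
elim: s w => [|a s IH] w /=; last by rewrite IH.
by elim: k w => //= k IH w; rewrite mulr0 add0r.
Qed.

Lemma dotwD w (I : seq nat) f g :
  dotw w [seq f i + g i | i <- I] =
  dotw w [seq f i | i <- I] + dotw w [seq g i | i <- I].
Proof.
elim: I w => [|i I IH] w /=; first by rewrite addr0.
by rewrite IH mulrDr addrACA.
Qed.

Lemma dotwZ w c s : dotw w [seq c * a | a <- s] = c * dotw w s.
Proof.
elim: s w => [|a s IH] w /=; first by rewrite mulr0.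
by rewrite IH mulrDr mulrCA.
Qed.

Lemma dotw_le w s t : (forall j, 0 <= w j) -> size s = size t ->
  (forall j, s`_j <= t`_j) -> dotw w s <= dotw w t.
Proof.
move=> w0 st h; rewrite (@dotwE _ _ (size s)) // (@dotwE _ t (size s)) ?st //.
by apply: ler_sum => j _; exact: ler_wpM2l.
Qed.

Definition weight (w : nat -> R) : Prop :=
  (forall j, 0 <= w j) /\ (forall j, w j.+1 <= w j).

Lemma weightS w : weight w -> weight (w \o S).
Proof. by move=> [w0 ww]; split=> j /=. Qed.

Lemma dotw_front w a t1 t2 : weight w -> all (fun b => b <= a) t1 ->
  dotw w (t1 ++ a :: t2) <= dotw w (a :: t1 ++ t2).
Proof.
elim: t1 w => [|b t1 IH] w hw //= /andP[ba h].
have := IH _ (weightS hw) h => /=.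
have := hw.2 0%N; have := hw.1 0%N.
move: (dotw _ _) (dotw _ _) => d1 d2 /=; nra.
Qed.

Lemma dotw_perm w s t : weight w -> sorted geR s -> perm_eq t s ->
  dotw w t <= dotw w s.
Proof.
elim: s t w => [|a s IH] t w hw; first by move=> _ /perm_nilP ->.
move=> /= sa; have sl := order_path_min geR_trans sa.
move=> ts; have at_ : a \in t by rewrite (perm_mem ts) mem_head.
case/splitPr: at_ ts => t1 t2 ts.
have ts' : perm_eq (t1 ++ t2) s.
  by rewrite -(perm_cons a) -[a :: _]/([:: a] ++ t1 ++ t2) -perm_catCA.
apply: le_trans (dotw_front _ hw _) _.
  apply/allP => b bt; have /allP := sl; apply.
  by rewrite -(perm_mem ts') mem_cat bt.
by rewrite /= lerD2l; apply: IH => //; [exact: weightS | exact: path_sorted sa].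
Qed.

Lemma Poly_cat0 (s : seq R) : exists k, s = Poly s ++ nseq k 0.
Proof.
exists (size s - size (Poly s))%N; apply: (@eq_from_nth _ 0).
  by rewrite size_cat size_nseq subnKC // size_Poly.
move=> i _; rewrite nth_cat coef_Poly.
case: ltnP => h //.
by rewrite nth_nseq if_same -coef_Poly nth_default.
Qed.

Let sabs (s : seq R) := sort geR [seq `|t| | t <- s].

Lemma sabs_cat0 s k : sabs (s ++ nseq k 0) = sabs s ++ nseq k 0.
Proof.
apply: (sorted_eq geR_trans geR_anti).
- exact: sort_sorted.
- have h : sorted geR (sabs s) by exact: sort_sorted.
  have h0 : all (fun a => 0 <= a) (sabs s).
    by rewrite all_sort; apply/allP => a /mapP[b _ ->].
  have g0 : geR 0 0 by exact: lexx.
  elim: (sabs s) h h0 => [|a r IH] /=.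
    by move=> _ _; elim: k => // -[|k] //= ->; rewrite g0.
  move=> pa /andP[a0 r0]; have := IH (path_sorted pa) r0.
  case: r pa {IH r0} => [|b r] /=; last by move=> /andP[-> _] ->.
  by move=> _; case: k => //= k ->; rewrite andbT; exact: a0.
- rewrite perm_sort map_cat map_nseq normr0.
  by rewrite perm_cat2r perm_sym perm_sort.
Qed.

Lemma wsumE w s : wsum w (Poly s) = dotw w (sabs s).
Proof.
have [k sk] := Poly_cat0 s; rewrite [in RHS]sk sabs_cat0 dotw_cat0.
rewrite (@dotwE _ _ (size (Poly s))) ?size_sort ?size_map //.
by apply: eq_bigr => j _; rewrite coef_Poly.
Qed.

Lemma poly_mkseq (xi : c00) n : (size xi <= n)%N ->
  Poly [seq xi`_i | i <- iota 0 n] = xi.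
Proof.
move=> h; apply/polyP => i; rewrite coef_Poly.
have [hi|hi] := ltnP i n; first by rewrite (nth_map 0%N) ?size_iota // nth_iota.
by rewrite !nth_default // ?size_map ?size_iota // (leq_trans h).
Qed.

Lemma wsum_dot w xi (I : seq nat) n : weight w -> (size xi <= n)%N ->
  perm_eq I (iota 0 n) -> dotw w [seq `|xi`_i| | i <- I] <= wsum w xi.
Proof.
move=> hw hn hI; rewrite -[in leRHS](poly_mkseq hn) wsumE.
apply: dotw_perm => //; first exact: sort_sorted.
by rewrite perm_sym perm_sort -map_comp; apply: perm_map; rewrite perm_sym.
Qed.

Lemma wsum_ge0 w xi : weight w -> 0 <= wsum w xi.
Proof.
move=> [w0 _]; apply: sumr_ge0 => j _; apply: mulr_ge0 => //.
rewrite coef_Poly.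
have : all (fun a => 0 <= a) (sabs xi).
  by rewrite all_sort; apply/allP => a /mapP[b _ ->].
have [h|h] := ltnP j (size (sabs xi)); last by rewrite nth_default.
by move=> /allP; apply; exact: mem_nth.
Qed.

Lemma wsum_eq0 w xi : weight w -> w 0%N = 1 -> wsum w xi = 0 -> xi = 0.
Proof.
move=> hw w1; rewrite -[in wsum _ _](polyseqK xi) wsumE => h.
suff : all (fun a => `|a| == 0) xi.
  move=> /allP z; apply/polyP => i; rewrite coef0.
  have [hi|hi] := ltnP i (size xi); last by rewrite nth_default.
  by apply/eqP; rewrite -normr_eq0; apply: z; exact: mem_nth.
suff : all (fun a => a == 0) (sabs xi) by rewrite all_sort all_map.
have h0 : all (fun a => 0 <= a) (sabs xi).
  by rewrite all_sort; apply/allP => a /mapP[b _ ->].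
have : sorted geR (sabs xi) by exact: sort_sorted.
case: (sabs xi) h h0 => //= a r; rewrite w1 mul1r => h /andP[a0 r0] pa.
have d0 : 0 <= dotw (w \o S) r.
  have := weightS hw; move: (w \o S) r0 => w'; clear -R.
  elim: r w' => //= b r IH w' /andP[b0 r0] hw'.
  by rewrite addr_ge0 ?mulr_ge0 ?(hw'.1) // IH //; exact: weightS.
have a00 : a = 0 by lra.
subst a; rewrite eqxx /=.
have /allP sl := order_path_min geR_trans pa.
by apply/allP => b br; rewrite eq_le (allP r0) // andbT; exact: sl.
Qed.

Lemma wsumZ w a xi : wsum w (a *: xi) = `|a| * wsum w xi.
Proof.
have e : a *: xi = Poly [seq a * t | t <- xi].
  apply/polyP => i; rewrite coefZ coef_Poly.
  have [hi|hi] := ltnP i (size xi); first by rewrite (nth_map 0).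
  by rewrite !nth_default ?size_map // mulr0.
rewrite e wsumE -[in RHS](polyseqK xi) wsumE -dotwZ; congr dotw.
apply: (sorted_eq geR_trans geR_anti); first exact: sort_sorted.
- apply: (homo_sorted (e := geR)); last exact: sort_sorted.
  by move=> x y xy; exact: ler_wpM2l.
- rewrite perm_sort perm_sym.
  apply: perm_trans (perm_map _ (permEl (perm_sort _ _))) _.
  rewrite -!map_comp; apply/permP => p; congr count.
  by apply: eq_map => t /=; rewrite normrM.
Qed.

Lemma wsumD w xi eta : weight w -> wsum w (xi + eta) <= wsum w xi + wsum w eta.
Proof.
move=> hw; set n := maxn (size xi) (size eta).
have h : (size (xi + eta)%R <= n)%N by exact: size_polyD.
rewrite -[in leLHS](poly_mkseq h) wsumE /sabs -map_comp sort_map.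
set I := sort _ _; have hI : perm_eq I (iota 0 n) by rewrite perm_sort.
apply: le_trans (lerD (@wsum_dot w xi I n hw _ hI) (@wsum_dot w eta I n hw _ hI)).
- rewrite -dotwD; apply: dotw_le; [exact: hw.1|by rewrite !size_map|].
  move=> j; have [hj|hj] := ltnP j (size I).
    by rewrite !(nth_map 0%N) //= coefD ler_normD.
  by rewrite !nth_default ?size_map.
- exact: leq_maxl.
- exact: leq_maxr.
Qed.

Lemma wsum1 w : wsum w 1 = w 0%N.
Proof.
have -> : 1 = Poly [:: 1] :> c00.
  by apply/polyP => -[|[|i]]; rewrite coef1 coef_Poly.
by rewrite wsumE /sabs /= normr1 addr0 mulr1.
Qed.

Lemma wsum_sym w (x y : seq R) : perm_eq y [seq `|t| | t <- x] ->
  wsum w (Poly x) = wsum w (Poly y).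
Proof.
move=> h; rewrite !wsumE; congr dotw.
apply/(perm_sortP geR_total geR_trans geR_anti).
rewrite perm_sym; apply: perm_trans (perm_map _ h) _.
by rewrite -map_comp (eq_map (g := fun t => `|t|)) // => t /=; rewrite normr_id.
Qed.

Lemma rearr_id xi : c00star xi -> rearr xi = xi.
Proof.
move=> hx; have e : [seq `|t| | t <- xi] = xi.
  apply: (@eq_from_nth _ 0); rewrite size_map // => i hi.
  by rewrite (nth_map 0) // ger0_norm //; exact: (hx i).1.
rewrite /rearr e sorted_sort ?polyseqK //.
by apply/(sortedP 0) => i _; exact: (hx i).2.
Qed.

Lemma wsum_c00star w xi : c00star xi ->
  wsum w xi = \sum_(j < size xi) w j * xi`_j.
Proof. by move=> hx; rewrite /wsum rearr_id. Qed.

Definition snf_weighted (w : nat -> R) (hw : weight w) (w1 : w 0%N = 1) :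
    snfunction :=
  @SNFunction (wsum w) (fun xi => wsum_ge0 xi hw)
    (fun xi => wsum_eq0 hw w1) (wsumZ w) (fun xi eta => wsumD xi eta hw)
    (etrans (wsum1 w) w1) (@wsum_sym w).

Lemma weight_cst1 : weight (fun=> 1).
Proof. by split=> j. Qed.

Definition Phi1 : snfunction := @snf_weighted (fun=> 1) weight_cst1 erefl.

Section adjoint.
Variable Phi : snfunction.

(* The maximum is attained, so it is a supremum. On c00star, [wsum (nth 0 xi) eta]
   is \sum_j xi_j eta_j. *)
Definition adjoint_fun (eta : c00) : R :=
  sup [set wsum (fun j => xi`_j) eta | xi in [set xi | c00star xi /\ Phi xi = 1]].

Lemma c00star_weight (xi : c00) : c00star xi -> weight (fun j => xi`_j).
Proof. by move=> h; split=> j; have [] := h j. Qed.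

Lemma c00star1 : c00star 1.
Proof. by move=> [|j]; rewrite !coef1. Qed.

Lemma snf_first xi : c00star xi -> xi`_0 <= Phi xi.
Proof.
move=> hx; pose s : seq R := [seq (if i == 0%N then 1 else -1) * xi`_i | i <- iota 0 (size xi)].
have -> : xi`_0 = Phi (xi`_0 *: 1).
  by rewrite snfZ snf1 mulr1 ger0_norm //; exact: (hx 0%N).1.
have e : xi`_0 *: 1 = (1 / 2) *: (xi + Poly s).
  apply/polyP => i; rewrite !coefZ coefD coef1 coef_Poly.
  have [hi|hi] := ltnP i (size xi).
    rewrite (nth_map 0%N) ?size_iota // nth_iota // add0n.
    by case: i hi => [|i] _ /=; lra.
  rewrite [X in X + _]nth_default // [X in _ + X]nth_default ?size_map ?size_iota //.
  case: i hi => [|i] hi /=; last by lra.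
  by rewrite nth_default //; lra.
have es : Phi (Poly s) = Phi xi.
  rewrite -[in RHS](polyseqK xi); apply: snf_sym.
  rewrite (_ : map _ _ = xi) //; apply: (@eq_from_nth _ 0).
    by rewrite !size_map size_iota.
  move=> i; rewrite !size_map size_iota => hi.
  rewrite (nth_map 0) ?size_map ?size_iota // (nth_map 0%N) ?size_iota //.
  rewrite nth_iota // add0n normrM [`|xi`_i|]ger0_norm ?(hx i).1 //.
  by case: eqP; rewrite ?normrN normr1 mul1r.
rewrite e snfZ ger0_norm ?divr_ge0 //.
have := snfD Phi xi (Poly s); rewrite es; lra.
Qed.

Let A (eta : c00) : set R :=
  [set wsum (fun j => xi`_j) eta | xi in [set xi | c00star xi /\ Phi xi = 1]].

Let A_ub eta : ubound (A eta) (wsum (fun=> 1) eta).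
Proof.
move=> _ [xi [hx px] <-]; apply: ler_sum => j _.
have h0 : 0 <= (rearr eta)`_j.
  rewrite coef_Poly.
  have [h|h] := ltnP j (size (sabs eta)); last by rewrite nth_default.
  have : all (fun a => 0 <= a) (sabs eta).
    by rewrite all_sort; apply/allP => a /mapP[b _ ->].
  by move=> /allP; apply; exact: mem_nth.
apply: ler_wpM2r => //.
apply: le_trans (_ : xi`_0 <= 1); last by rewrite -px; exact: snf_first.
have : forall k, xi`_k <= xi`_0.
  by elim=> // k; apply: le_trans; exact: (hx k).2.
exact.
Qed.

Let A_one eta : A eta (wsum (fun j => (1 : c00)`_j) eta).
Proof. by exists 1 => //; split; [exact: c00star1 | exact: snf1]. Qed.

Let A_sup eta : has_sup (A eta).
Proof.
by split; [exists (wsum (fun j => (1 : c00)`_j) eta) | exists (wsum (fun=> 1) eta)].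
Qed.

Let A_le eta r : A eta r -> r <= adjoint_fun eta.
Proof. exact: (sup_upper_bound (A_sup eta)). Qed.

Let le_A eta r : (forall xi, c00star xi -> Phi xi = 1 ->
  wsum (fun j => xi`_j) eta <= r) -> adjoint_fun eta <= r.
Proof.
move=> h; apply: ge_sup; first exact: (A_sup eta).1.
by move=> _ [xi [hx px] <-]; exact: h.
Qed.

Lemma adjoint_ge0 eta : 0 <= adjoint_fun eta.
Proof.
apply: le_trans (A_le (A_one eta)).
exact/wsum_ge0/c00star_weight/c00star1.
Qed.

Lemma adjoint_eq0 eta : adjoint_fun eta = 0 -> eta = 0.
Proof.
move=> h; apply: (wsum_eq0 (c00star_weight c00star1)); first by rewrite coef1.
apply: le_anti; apply/andP; split.
  by apply: le_trans (A_le (A_one eta)) _; rewrite h.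
exact/wsum_ge0/c00star_weight/c00star1.
Qed.

Lemma adjointZ a eta : adjoint_fun (a *: eta) = `|a| * adjoint_fun eta.
Proof.
have hle b z : adjoint_fun (b *: z) <= `|b| * adjoint_fun z.
  apply: le_A => xi hx px; rewrite wsumZ ler_wpM2l //.
  by apply: A_le; exists xi.
apply/eqP; rewrite eq_le hle /=.
have [->|a0] := eqVneq a 0; first by rewrite normr0 mul0r adjoint_ge0.
have := hle a^-1 (a *: eta); rewrite scalerA mulVf // scale1r normfV.
by rewrite -ler_pdivlMl ?invr_gt0 ?normr_gt0 // invrK.
Qed.

Lemma adjointD eta zeta :
  adjoint_fun (eta + zeta) <= adjoint_fun eta + adjoint_fun zeta.
Proof.
apply: le_A => xi hx px.
apply: le_trans (wsumD _ _ (c00star_weight hx)) _.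
by apply: lerD; apply: A_le; exists xi.
Qed.

Lemma adjoint1 : adjoint_fun 1 = 1.
Proof.
apply/eqP; rewrite eq_le; apply/andP; split.
  by apply: le_A => xi hx px; rewrite wsum1 -px; exact: snf_first.
by apply: A_le; exists 1; [split; [exact: c00star1|exact: snf1] | rewrite wsum1 coef1].
Qed.

Lemma adjoint_sym (x y : seq R) : perm_eq y [seq `|t| | t <- x] ->
  adjoint_fun (Poly x) = adjoint_fun (Poly y).
Proof.
move=> h; congr sup; apply/seteqP; split=> _ [xi hx <-]; exists xi => //.
  by rewrite (wsum_sym _ h).
by rewrite (wsum_sym _ h).
Qed.

Definition adjoint : snfunction :=
  SNFunction adjoint_ge0 adjoint_eq0 adjointZ adjointD adjoint1 adjoint_sym.

End adjoint.

End snfunctions.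
Arguments Phi1 {R}.

Section norming.
Variable R : realType.
Local Notation H := (l2 R).

Definition opsnorm (Phi : snfunction R) (T : H -> H) : R :=
  sup (range (fun n => Phi (\poly_(j < n) singval T j))).

(* Used for Phi equivalent to [Phi1], where the two [opsnorm]s are suprema of
   bounded sets. *)
Definition norming (Phi : snfunction R) : set {linear H -> H} :=
  [set T : {linear H -> H} | bounded_op T /\
    exists K : {linear H -> H}, [/\ trace_class K, opsnorm Phi K = 1 &
      modulus (trace (T \o K)) = opsnorm (adjoint Phi) T]].

End norming.

Section Phi_pi.
Variable R : realType.

Definition PiSet : set (nat -> R) :=
  [set p : R^nat | [/\ forall k, 0 < p k, p 0%N = 1, 0 < limn p &
    forall k, p k.+1 <= p k]].

Lemma PiSet_weight p : PiSet p -> weight p.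
Proof. by case=> p0 _ _ pp; split=> // j; exact: ltW. Qed.

Lemma PiSet_first p : PiSet p -> p 0%N = 1.
Proof. by case. Qed.

Definition Phi_pi (p : nat -> R) (hp : PiSet p) : snfunction R :=
  snf_weighted (PiSet_weight hp) (PiSet_first hp).

End Phi_pi.

(* Main.v *)
(**
Write L = lim pi, so 0 < L < 1 = pi_1. Since L <= pi_j <= 1, the norms satisfy
L Phi_1 <= Phi_pi <= Phi_1. All singular numbers of I are 1, and testing the
adjoint norm on constant sequences gives ||I|| >= n / (pi_1 + ... + pi_n),
which tends to 1/L by Cesaro. If Phi_pi(K) = 1, then
L sum_j s_j(K) + (1 - L) s_1(K) <= sum_j pi_j s_j(K) = 1, so
|Tr K| <= sum_j s_j(K) < 1/L because s_1(K) > 0.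

The inequality |Tr K| <= sum_j s_j(K) is proved for each partial sum of the
diagonal: if B is the n x n corner of K, an orthonormal eigenbasis (w_i) of the
Gram matrix gives |Tr B| <= sum_i |w_i B|, and every F of rank at most j kills
a unit vector in the span of w_0, ..., w_j, whence |w_j B| <= s_j(K).
*)
Require Import Defs.
From mathcomp Require Import all_boot all_order all_algebra.
From mathcomp Require Import complex lra perm sesquilinear spectral.
From mathcomp Require Import all_classical all_reals all_analysis.

Import Order.TTheory GRing.Theory Num.Theory.
Import numFieldNormedType.Exports.

Local Open Scope classical_set_scope.
Local Open Scope ring_scope.

Set Implicit Arguments.
Unset Strict Implicit.
Unset Printing Implicit Defensive.

(** * Singular value frames of a square complex matrix *)

Section singular_frame.
Variable R : realType.
Local Notation C := R[i].
Local Open Scope sesquilinear_scope.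
Local Open Scope complex_scope.

Lemma modulusE (z : C) : (modulus z)%:C = `|z|.
Proof. by []. Qed.

Lemma dotmxC n (u v : 'rV[C]_n) : dotmx u v = \sum_k u 0 k * (v 0 k)^*.
Proof. by rewrite dotmxE mxE; apply: eq_bigr => k _; rewrite !mxE. Qed.

Lemma dotmx_modulus n (u : 'rV[C]_n) :
  dotmx u u = (\sum_k modulus (u 0 k) ^+ 2)%:C.
Proof.
rewrite dotmxC rmorph_sum; apply: eq_bigr => k _.
by rewrite rmorphXn /= modulusE sqr_normc.
Qed.

(** Pythagoras for an orthogonal family. It serves with [e] constantly 1 for a frame and with
    squared lengths for its image under a matrix. *)
Lemma dotmx_orthogonal_sum m n (f : 'I_m -> 'rV[C]_n) (e : 'I_m -> R)
    (y : 'I_m -> C) :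
  (forall i j, dotmx (f i) (f j) = ((i == j)%:R * e i)%:C) ->
  \sum_k modulus ((\sum_i y i *: f i) 0 k) ^+ 2 =
  \sum_i modulus (y i) ^+ 2 * e i.
Proof.
move=> fe; apply: complexI; rewrite -dotmx_modulus linear_sumlz rmorph_sum /=.
apply: eq_bigr => i _; rewrite linear_sumr (bigD1 i) //= big1 ?addr0.
  rewrite linearZl_LR linearZr_LR /= fe eqxx mul1r mulrA rmorphM rmorphXn /=.
  by rewrite modulusE sqr_normc.
move=> j ji; rewrite linearZl_LR linearZr_LR /= fe eq_sym (negPf ji).
by rewrite mul0r !mulr0.
Qed.

(** The [w i] are the rows of a unitary matrix diagonalising [G], so their images under [B] are
    mutually orthogonal; the lengths [d i] are the singular values of [B]. In this basis the trace
    is the sum of the products of [w i *m B] with [w i], and Cauchy-Schwarz bounds each by [d i]. *)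
Lemma singular_frame_unsorted n (B : 'M[C]_n) :
  exists w : 'I_n -> 'rV[C]_n, exists d : 'I_n -> R,
    [/\ forall i, 0 <= d i,
        forall i j, dotmx (w i) (w j) = ((i == j)%:R * 1)%:C,
        forall i j, dotmx (w i *m B) (w j *m B) = ((i == j)%:R * d i ^+ 2)%:C
      & modulus (\tr B) <= \sum_i d i].
Proof.
pose G := B *m B^t*.
have hG : G \is normalmx.
  apply/hermitian_normalmx/is_hermitianmxP; rewrite expr0 scale1r.
  by rewrite /G trmx_mul map_mxM trmxCK.
pose P := spectralmx G; have uP : P \is unitarymx by exact: spectral_unitarymx.
have eP : P *m P^t* = 1%:M by apply/unitarymxP.
pose d i := Num.sqrt (\sum_k modulus ((row i P *m B) 0 k) ^+ 2).
have wE i j : dotmx (row i P) (row j P) = ((i == j)%:R * 1)%:C.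
  rewrite mulr1 rmorph_nat; exact: (row_unitarymxP uP).
have s0 i : 0 <= \sum_k modulus ((row i P *m B) 0 k) ^+ 2.
  by apply: sumr_ge0 => k _; exact: sqr_ge0.
have BE i j : dotmx (row i P *m B) (row j P *m B) = ((i == j)%:R * d i ^+ 2)%:C.
  have [<-|ij] := eqVneq i j; first by rewrite mul1r sqr_sqrtr // dotmx_modulus.
  rewrite mul0r -!row_mul dotmxC.
  transitivity ((P *m G *m P^t*) i j).
    rewrite /G !mulmxA -[_ *m B^t* *m _]mulmxA -map_mxM -trmx_mul !mxE.
    by apply: eq_bigr => k _; rewrite !mxE.
  (* By the spectral theorem the conjugate of [G] by [P] is diagonal, so its entry at [i != j]
     vanishes. *)
  rewrite (orthomx_spectralP hG) -/P invmx_unitary // !mulmxA eP mul1mx.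
  by rewrite -mulmxA eP mulmx1 mxE (negPf ij).
exists (fun i => row i P), d; split=> //; first by move=> i; exact: sqrtr_ge0.
have -> : \tr B = \sum_i dotmx (row i P *m B) (row i P).
  have {1}-> : B = P^t* *m P *m B.
    by rewrite -invmx_unitary // mulVmx ?unitarymx_unit // mul1mx.
  rewrite -mulmxA mxtrace_mulC; apply: eq_bigr => i _.
  by rewrite dotmxC -row_mul !mxE; apply: eq_bigr => k _; rewrite !mxE.
rewrite -lecR modulusE rmorph_sum /=; apply: le_trans (ler_norm_sum _ _ _) _.
apply: ler_sum => i _.
apply: le_trans (CauchySchwarz_sqrt (@dotmx _ _) _ _) _.
rewrite /= wE BE eqxx !mul1r sqrtC1 mulr1 rmorphXn /= sqrCK //.
by rewrite lecR sqrtr_ge0.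
Qed.

Lemma nonincreasing_perm n (d : 'I_n -> R) :
  exists s : 'S_n, forall i j : 'I_n, (i <= j)%N -> d (s j) <= d (s i).
Proof.
pose r := [rel a b : R | b <= a].
have rtr : transitive r by move=> b a c /= ab bc; exact: (le_trans bc ab).
have rtot : total r by move=> a b; exact: le_total.
pose t := [tuple d i | i < n].
(* Sorting is turned into a permutation of indices, which can reorder [w] and [d] simultaneously. *)
have /tuple_permP[s es] : perm_eq (sort_tuple r t) t by rewrite perm_sort.
exists s => i j ij.
have sn (k : 'I_n) : nth 0 (sort r t) k = d (s k).
  by rewrite [X in nth _ X]es -tnth_nth tnth_mktuple tnth_mktuple.
have hs : size (sort r t) = n by rewrite size_sort size_tuple.
have rrefl : reflexive r by move=> a /=.
have := sorted_leq_nth rtr rrefl 0 (sort_sorted rtot t) i j.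
rewrite !inE hs !sn => h; exact: h.
Qed.

Lemma singular_frame n (B : 'M[C]_n) :
  exists w : 'I_n -> 'rV[C]_n, exists d : 'I_n -> R,
    [/\ forall i, 0 <= d i,
        forall i j : 'I_n, (i <= j)%N -> d j <= d i,
        forall i j, dotmx (w i) (w j) = ((i == j)%:R * 1)%:C,
        forall i j, dotmx (w i *m B) (w j *m B) = ((i == j)%:R * d i ^+ 2)%:C
      & modulus (\tr B) <= \sum_i d i].
Proof.
have [w [d [d0 wE BE tB]]] := singular_frame_unsorted B.
have [s hs] := nonincreasing_perm d.
exists (w \o s), (d \o s); split=> [i|i j|i j|i j|].
- exact: d0.
- exact: hs.
- by rewrite [LHS]wE (inj_eq perm_inj).
- by rewrite [LHS]BE (inj_eq perm_inj).
- by rewrite (reindex_inj (@perm_inj _ s)) in tB.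
Qed.

End singular_frame.

(** * Norm estimates and singular numbers on l2 *)

Section l2_operators.
Variable R : realType.
Local Notation C := R[i].
Local Notation H := (l2 R).
Local Open Scope complex_scope.
Implicit Types (x y : H) (T F : {linear H -> H}).

Lemma l2_sumE (I : finType) (a : I -> C) (v : I -> H) k :
  (\sum_i a i *: v i : H) k = \sum_i a i * v i k.
Proof.
rewrite -[LHS]/(val (\sum_i a i *: v i) k) linear_sum fct_sumE.
by apply: eq_bigr => i _; rewrite linearZ.
Qed.

Lemma l2norm_ge0 x : 0 <= l2norm x.
Proof. exact: sqrtr_ge0. Qed.

Lemma sqr_series_cvg x : cvgn (sqr_series x).
Proof. by have /asboolP := l2_valP x. Qed.

Lemma sqr_series_le_lim x n : sqr_series x n <= limn (sqr_series x).
Proof.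
apply: nondecreasing_cvgn_le; last exact: sqr_series_cvg.
by apply: nondecreasing_series => k _ _; exact: sqr_ge0.
Qed.

Lemma sqr_l2norm x : l2norm x ^+ 2 = limn (sqr_series x).
Proof.
rewrite sqr_sqrtr //; apply: le_trans (sqr_series_le_lim x 0).
by rewrite /sqr_series seriesEord /= big_ord0.
Qed.

Lemma sqr_partial_le x n : \sum_(k < n) modulus (x k) ^+ 2 <= l2norm x ^+ 2.
Proof.
rewrite sqr_l2norm; apply: le_trans (sqr_series_le_lim x n).
by rewrite /sqr_series seriesEord.
Qed.

Lemma sqr_l2norm_le x M :
  (forall n, \sum_(k < n) modulus (x k) ^+ 2 <= M) -> l2norm x ^+ 2 <= M.
Proof.
move=> h; rewrite sqr_l2norm; apply: limr_le; first exact: sqr_series_cvg.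
by apply: nearW => n; rewrite /sqr_series seriesEord; exact: h.
Qed.

Lemma modulusN (z : C) : modulus (- z) = modulus z.
Proof. exact: normcN. Qed.

Lemma sqr_modulus_real (r : R) : modulus r%:C ^+ 2 = r ^+ 2.
Proof. by rewrite /modulus /= expr0n addr0 sqr_sqrtr // sqr_ge0. Qed.

(** A crude form of the triangle inequality, enough to see that a difference of bounded operators is
    bounded on the unit ball. *)
Lemma sqr_l2norm_sub_le x y :
  l2norm (x - y) ^+ 2 <= 2 * l2norm x ^+ 2 + 2 * l2norm y ^+ 2.
Proof.
apply: sqr_l2norm_le => n.
have := sqr_partial_le x n; have := sqr_partial_le y n => hy hx.
suff : \sum_(k < n) modulus ((x - y) k) ^+ 2 <=
    2 * (\sum_(k < n) modulus (x k) ^+ 2) +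
    2 * \sum_(k < n) modulus (y k) ^+ 2 by lra.
rewrite !mulr_sumr -big_split /=; apply: ler_sum => k _.
rewrite -[in leRHS](modulusN (y k)).
exact: sqr_modulusD.
Qed.

Lemma bounded_op_bound T : bounded_op T ->
  exists M : R, forall x, l2norm x <= 1 -> l2norm (T x) ^+ 2 <= M.
Proof.
move=> [M hM]; exists (M ^+ 2) => x x1.
have := hM x; have := l2norm_ge0 x; have := l2norm_ge0 (T x).
move: (l2norm (T x)) (l2norm x) x1 => a b b1 a0 b0 ab.
have : a ^+ 2 <= (M * b) ^+ 2 by rewrite lerXn2r // nnegrE // (le_trans a0).
rewrite exprMn => /le_trans; apply; rewrite ler_piMr ?sqr_ge0 //.
by rewrite expr_le1.
Qed.

Lemma le_opnorm_sub T F x : bounded_op T -> bounded_op F -> l2norm x <= 1 ->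
  l2norm (T x - F x) <= opnorm (fun z => T z - F z).
Proof.
move=> /bounded_op_bound[M hM] /bounded_op_bound[N hN] x1.
apply: ub_le_sup; last by exists x.
(* The squared norm is at most [2 * M + 2 * N], and a <= 1 + a^2 avoids a square root. *)
exists (1 + (2 * M + 2 * N)) => _ [z /= z1 <-].
have := sqr_l2norm_sub_le (T z) (F z); have := hM z z1; have := hN z z1.
have := l2norm_ge0 (T z - F z); nra.
Qed.

Lemma opnorm_ge0 (G : H -> H) : 0 <= opnorm G.
Proof.
rewrite /opnorm.
(* For an unbounded map [sup] takes its default value 0. *)
set A := [set _ | _ in _]; have [hs|/sup_out -> //] := pselect (has_sup A).
have [[_ [x x1 _]] _] := hs.
apply: le_trans (l2norm_ge0 (G x)) _.
by apply: sup_upper_bound hs _ _; exists x.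
Qed.

Lemma l2norm0 : l2norm (0 : H) = 0.
Proof.
have := l2norm_ge0 0; have : l2norm (0 : H) ^+ 2 <= 0; last by nra.
apply: sqr_l2norm_le => n; rewrite big1 // => k _.
by rewrite -[LHS]/(modulus 0 ^+ 2) modulus0 expr0n.
Qed.

Lemma bounded_op0 : bounded_op (\0%R : H -> H).
Proof. by exists 0 => x; rewrite mul0r l2norm0. Qed.

Lemma rank_le0 j : rank_le (\0%R : H -> H) j.
Proof.
exists (fun=> 0) => x; exists (fun=> 0).
by rewrite big1 // => i _; rewrite scaler0.
Qed.

Lemma singval_le (T : H -> H) F j : bounded_op F -> rank_le F j ->
  singval T j <= opnorm (fun x => T x - F x).
Proof.
move=> bF rF; apply: ge_inf; last by exists F.
by exists 0 => _ [G _ <-]; exact: opnorm_ge0.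
Qed.

Lemma le_singval (T : H -> H) j c :
  (forall F, bounded_op F -> rank_le F j -> c <= opnorm (fun x => T x - F x)) ->
  c <= singval T j.
Proof.
move=> h; apply: lb_le_inf; last by move=> _ [F [bF rF] <-]; exact: h.
exists (opnorm (fun x => T x - (\0%R : {linear H -> H}) x)), \0%R => //.
by split; [exact: bounded_op0|exact: rank_le0].
Qed.

Lemma singval_ge0 (T : H -> H) j : 0 <= singval T j.
Proof.
apply: le_singval => F _ _; exact: opnorm_ge0.
Qed.

Lemma rank_leS (G : H -> H) j : rank_le G j -> rank_le G j.+1.
Proof.
move=> [v hv]; exists (fun i => oapp v 0 (unlift ord0 i)) => x.
have [c ->] := hv x; exists (fun i => oapp c 0 (unlift ord0 i)).
rewrite big_ord_recl unlift_none /= scaler0 add0r.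
by apply: eq_bigr => i _; rewrite liftK.
Qed.

Lemma singvalS_le (T : H -> H) j : singval T j.+1 <= singval T j.
Proof.
by apply: le_singval => F bF rF; apply: singval_le => //; exact: rank_leS.
Qed.

(** A dimension count: the coefficients of the [j.+1] images on [j] spanning vectors form a matrix
    with nonzero left kernel. A kernel vector is then normalised. *)
Lemma rank_le_null F j (w : 'I_j.+1 -> H) : rank_le F j ->
  exists y : 'I_j.+1 -> C,
    \sum_i modulus (y i) ^+ 2 = 1 /\ F (\sum_i y i *: w i) = 0.
Proof.
move=> [v hv]; have [c hc] := choice (fun k => hv (w k)).
pose A : 'M[C]_(j.+1, j) := \matrix_(k, i) c k i.
have : kermx A != 0.
  rewrite -mxrank_eq0 mxrank_ker subn_eq0 -ltnNge.
  by rewrite ltnS rank_leq_col.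
move=> /rowV0Pn[u /sub_kermxP uA u0].
pose s := \sum_i modulus (u 0 i) ^+ 2.
have s_ge0 : 0 <= s by apply: sumr_ge0 => i _; exact: sqr_ge0.
have s0 : s != 0.
  apply: contra u0 => /eqP s0; apply/eqP/rowP => i; rewrite mxE.
  have /psumr_eq0P := s0 => /(_ (fun k _ => sqr_ge0 _) i erefl) /eqP.
  by rewrite sqrf_eq0 => /eqP; exact: ComplexField.Normc.eq0_normc.
pose t : C := ((Num.sqrt s)^-1)%:C.
have mt : modulus t ^+ 2 = s^-1.
  by rewrite sqr_modulus_real exprVn sqr_sqrtr.
exists (fun i => t * u 0 i); split.
  transitivity (\sum_i s^-1 * modulus (u 0 i) ^+ 2).
  2: by rewrite -mulr_sumr mulVf.
  apply: eq_bigr => i _.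
  by rewrite /modulus ComplexField.Normc.normcM exprMn -mt.
rewrite linear_sum /=.
transitivity (\sum_i (t * (u *m A) 0 i) *: v i).
  under eq_bigr do rewrite linearZ /= hc scaler_sumr.
  rewrite exchange_big; apply: eq_bigr => i _ /=.
  rewrite mxE mulr_sumr scaler_suml.
  by apply: eq_bigr => k _; rewrite mxE scalerA mulrA.
by rewrite uA big1 // => i _; rewrite mxE mulr0 scale0r.
Qed.

(** The lower half of the min-max principle: each competitor [F] vanishes at some test vector [x],
    where [T - F] agrees with [T]. *)
Lemma singval_ge T j (w : 'I_j.+1 -> H) c : bounded_op T -> 0 <= c ->
  (forall y : 'I_j.+1 -> C, \sum_i modulus (y i) ^+ 2 = 1 ->
    let x := \sum_i y i *: w i in
    l2norm x <= 1 /\ c <= l2norm (T x)) ->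
  c <= singval T j.
Proof.
move=> bT c0 h; apply: le_singval => F bF rF.
have [y [y1 Fy]] := rank_le_null w rF.
have [x1 cx] := h _ y1.
by apply: le_trans (le_opnorm_sub bT bF x1); rewrite Fy subr0.
Qed.
End l2_operators.

(** * Finite sections and the bound on partial traces *)

Section l2_trace.
Variable R : realType.
Local Notation C := R[i].
Local Notation H := (l2 R).
Local Open Scope complex_scope.
Implicit Types (K : {linear H -> H}).

(** Padding by zeros, written as a linear combination so that linear maps distribute over it. *)
Definition l2_of_row n (u : 'rV[C]_n) : H := \sum_i u 0 i *: l2basis R i.

Lemma l2_of_row_ord n (u : 'rV[C]_n) (i : 'I_n) : l2_of_row u i = u 0 i.
Proof.
rewrite l2_sumE (bigD1 i) //= eqxx mulr1 big1 ?addr0 // => k ki.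
by rewrite /= -[_ == _]/(i == k) eq_sym (negPf ki) mulr0.
Qed.

Lemma l2_of_row_default n (u : 'rV[C]_n) k : (n <= k)%N -> l2_of_row u k = 0.
Proof.
move=> nk; rewrite l2_sumE big1 // => i _ /=.
by rewrite gtn_eqF ?mulr0 // (leq_trans (ltn_ord i)).
Qed.

Lemma l2_of_row_sum m n (y : 'I_m -> C) (u : 'I_m -> 'rV[C]_n) :
  \sum_i y i *: l2_of_row (u i) = l2_of_row (\sum_i y i *: u i).
Proof.
rewrite /l2_of_row; under eq_bigr do rewrite scaler_sumr.
rewrite exchange_big; apply: eq_bigr => k _; rewrite summxE scaler_suml.
by apply: eq_bigr => i _; rewrite mxE scalerA.
Qed.

Lemma sqr_l2norm_row n (u : 'rV[C]_n) :
  l2norm (l2_of_row u) ^+ 2 = \sum_i modulus (u 0 i) ^+ 2.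
Proof.
have e : \sum_(i < n) modulus (l2_of_row u i) ^+ 2 =
    \sum_i modulus (u 0 i) ^+ 2.
  by apply: eq_bigr => i _; rewrite l2_of_row_ord.
apply/eqP; rewrite eq_le -{2}e sqr_partial_le andbT; apply: sqr_l2norm_le => m.
(* The range [n + m] contains the whole support and also dominates the partial sum up to [m]. *)
have : \sum_(i < n + m) modulus (l2_of_row u i) ^+ 2 =
    \sum_i modulus (u 0 i) ^+ 2.
  rewrite big_split_ord /= e [X in _ + X]big1 ?addr0 // => k _.
  by rewrite l2_of_row_default ?leq_addr // modulus0 expr0n.
move=> <-; rewrite addnC big_split_ord /= lerDl.
by apply: sumr_ge0 => k _; exact: sqr_ge0.
Qed.

Lemma bounded_op_id : bounded_op (idfun : H -> H).
Proof. by exists 1 => x; rewrite mul1r. Qed.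

Lemma singval_id j : singval (idfun : H -> H) j = 1.
Proof.
apply/eqP; rewrite eq_le; apply/andP; split.
  (* The zero operator is the competitor for the upper bound; the first [j.+1] basis vectors give
     the lower bound. *)
  apply: le_trans (singval_le (idfun : H -> H) (@bounded_op0 R) _) _.
    exact: rank_le0.
  apply: ge_sup.
    by exists (l2norm (0 - 0 : H)), 0 => //=; rewrite l2norm0.
  by move=> _ [x x1 <-] /=; rewrite subr0.
pose w (k : 'I_j.+1) := l2_of_row (delta_mx 0 k : 'rV[C]_j.+1).
apply: (@singval_ge _ (idfun : {linear H -> H}) _ w) => //.
  exact: bounded_op_id.
move=> y y1 x; suff x1 : l2norm x ^+ 2 = 1.
  have := l2norm_ge0 x; rewrite /=; split; nra.
rewrite /x l2_of_row_sum sqr_l2norm_row -[RHS]y1; apply: eq_bigr => i _.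
congr (modulus _ ^+ 2); rewrite summxE (bigD1 i) //= big1 ?addr0.
  by rewrite !mxE !eqxx mulr1.
by move=> k ki; rewrite !mxE eqxx eq_sym (negPf ki) mulr0.
Qed.

Lemma linear_l2_of_row K n (u : 'rV[C]_n) (k : 'I_n) :
  K (l2_of_row u) k =
  (u *m \matrix_(i, j < n) K (l2basis R i) j) 0 k.
Proof.
rewrite linear_sum mxE; under eq_bigr do rewrite linearZ.
by rewrite l2_sumE; apply: eq_bigr => i _; rewrite mxE.
Qed.

(* Finite sections decrease singular values, and the trace norm of a matrix
   bounds its trace. *)
Lemma partial_trace_le K n : bounded_op K ->
  modulus (\sum_(i < n) K (l2basis R i) i) <= \sum_(j < n) singval K j.
Proof.
move=> bK; pose B : 'M[C]_n := \matrix_(i, j) K (l2basis R i) j.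
have [w [d [d0 dd wE BE tB]]] := singular_frame B.
have -> : \sum_(i < n) K (l2basis R i) i = \tr B.
  by apply: eq_bigr => i _; rewrite mxE.
apply: le_trans tB _; apply: ler_sum => j _.
(* The test space for the j-th singular number is spanned by the frame vectors with the [j.+1]
   largest values [d]. *)
pose v (k : 'I_j.+1) := widen_ord (ltn_ord j) k.
have v_eq i k : (v i == v k) = (i == k) by [].
apply: (@singval_ge _ K _ (fun k => l2_of_row (w (v k)))) => // y y1 x.
rewrite {}/x l2_of_row_sum; split.
  rewrite -(@expr_le1 _ 2) ?l2norm_ge0 // sqr_l2norm_row.
  rewrite (@dotmx_orthogonal_sum _ _ _ _ (fun=> 1)).
    by under eq_bigr do rewrite mulr1; rewrite y1.
  by move=> i k; rewrite wE v_eq.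
rewrite -(@ler_pXn2r _ 2) ?nnegrE ?l2norm_ge0 //.
(* Keeping only the first [n] coordinates of the image replaces [K] by its corner [B]; Pythagoras
   and the ordering of [d] then give at least [d j ^+ 2]. *)
apply: le_trans (sqr_partial_le _ n).
under eq_bigr do rewrite linear_l2_of_row -/B mulmx_suml.
under eq_bigr do under eq_bigr do rewrite -scalemxAl.
rewrite (@dotmx_orthogonal_sum _ _ _ _ (fun k => d (v k) ^+ 2)); last first.
  by move=> i k; rewrite BE v_eq.
rewrite -[leLHS]mul1r -y1 mulr_suml; apply: ler_sum => i _.
rewrite ler_wpM2l ?sqr_ge0 // lerXn2r ?nnegrE //.
by apply: dd; exact: (leq_ord i).
Qed.

End l2_trace.

(** * From partial traces to the trace *)

Section trace_limit.
Variable R : realType.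
Local Open Scope complex_scope.

Lemma modulus_trace_le (A : l2 R -> l2 R) b : 0 <= b ->
  (forall n, modulus (\sum_(i < n) A (l2basis R i) i) <= b) ->
  modulus (trace A) <= b.
Proof.
move=> b0 hb; rewrite /trace; set u := series _.
(* A divergent diagonal series has the default limit 0, which [b0] covers. *)
have [cu|/dvgP ->] := pselect (cvgn u); last first.
  by rewrite -[point]/(0 : R[i]) modulus0.
rewrite leNgt; apply/negP => bl.
(* The excess of the limit over [b] is the tolerance: a partial sum this close would itself exceed
   [b]. *)
have e0 : 0 < (modulus (limn u) - b)%:C by rewrite ltcR subr_gt0.
have /cvgrPdist_lt/(_ _ e0)[n _ /(_ n (leqnn n))] := cu.
rewrite /= -modulusE ltcR.
have un : modulus (u n) <= b by rewrite /u seriesEord; exact: hb.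
have : modulus (limn u - u n + u n) <= modulus (limn u - u n) + modulus (u n).
  exact: le_normcD.
rewrite subrK; lra.
Qed.

End trace_limit.

(** * Weighted norming functions and their adjoints *)

Section weighted_norm.
Variable R : realType.
Implicit Types (xi : {poly R}) (w : nat -> R).

Lemma c00star_poly n (a : nat -> R) : (forall j, 0 <= a j) ->
  (forall j, a j.+1 <= a j) -> c00star (\poly_(j < n) a j).
Proof.
move=> a0 aS j; rewrite !coef_poly; have [jn|jn] := ltnP j n.
  by split=> //; case: ifP.
by rewrite ltnNge (leq_trans jn).
Qed.

(** Frees the summation range from [size xi], which depends on trailing zeros. *)
Lemma wsum_c00star_widen w xi n : c00star xi -> (size xi <= n)%N ->
  wsum w xi = \sum_(j < n) w j * xi`_j.
Proof.
move=> hx xn; rewrite wsum_c00star //.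
rewrite (big_ord_widen n (fun j => w j * xi`_j)) //.
rewrite big_mkcond /=; apply: eq_bigr => j _; case: ltnP => // h.
by rewrite nth_default // mulr0.
Qed.

Lemma wsum_poly w n (a : nat -> R) : (forall j, 0 <= a j) ->
  (forall j, a j.+1 <= a j) ->
  wsum w (\poly_(j < n) a j) = \sum_(j < n) w j * a j.
Proof.
move=> a0 aS; rewrite (@wsum_c00star_widen _ _ n) ?size_poly //.
  by apply: eq_bigr => j _; rewrite coef_poly ltn_ord.
exact: c00star_poly.
Qed.

Lemma rearr_ge0 xi j : 0 <= (rearr xi)`_j.
Proof.
rewrite coef_Poly; set s := sort _ _.
have [h|h] := ltnP j (size s); last by rewrite nth_default.
have : s`_j \in s by exact: mem_nth.
by rewrite mem_sort => /mapP[b _ ->].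
Qed.

Lemma wsum_le v w xi : (forall j, v j <= w j) -> wsum v xi <= wsum w xi.
Proof.
by move=> vw; apply: ler_sum => j _; apply: ler_wpM2r; rewrite ?rearr_ge0.
Qed.

Lemma wsum_scale c w xi : wsum (fun j => c * w j) xi = c * wsum w xi.
Proof. by rewrite /wsum mulr_sumr; apply: eq_bigr => j _; rewrite mulrA. Qed.

Lemma snf_gt0 (Phi : snfunction R) xi : xi != 0 -> 0 < Phi xi.
Proof.
move=> x0; rewrite lt_def snf_ge0 andbT; apply: contra x0 => /eqP h.
by apply/eqP; exact: snf_eq0 h.
Qed.

(** Since [l] bounds the weights below, a sequence of norm 1 has sum at most 1/l. The lower bound
    comes from testing a constant sequence of norm 1. *)
Lemma adjoint_weighted_cst w (hw : weight w) (w1 : w 0%N = 1) l n :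
  0 < l -> (forall j, l <= w j) ->
  adjoint (snf_weighted hw w1) (\poly_(j < n) 1) <= l^-1 /\
  n.+1%:R / (\sum_(j < n.+1) w j) <=
    adjoint (snf_weighted hw w1) (\poly_(j < n.+1) 1).
Proof.
move=> l0 lw.
have E m xi : wsum (fun j => xi`_j) (\poly_(j < m) 1) = \sum_(j < m) xi`_j.
  by rewrite wsum_poly //; apply: eq_bigr => j _; rewrite mulr1.
have ub m : ubound [set wsum (fun j => xi`_j) (\poly_(j < m) 1) |
    xi in [set xi | c00star xi /\ snf_weighted hw w1 xi = 1]] l^-1.
  move=> _ [xi [hx px] <-]; rewrite E -[leRHS]mul1r ler_pdivlMr // -px /=.
  (* This range covers the support of [xi] and splits off the first [m] terms; the remaining ones
     are nonnegative. *)
  rewrite (@wsum_c00star_widen _ _ (m + size xi)) ?leq_addl // big_split_ord /=.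
  rewrite -[leLHS]addr0 mulr_suml lerD //.
    apply: ler_sum => j _; rewrite mulrC ler_wpM2r //; exact: (hx _).1.
  apply: sumr_ge0 => j _; apply: mulr_ge0; [exact: hw.1|exact: (hx _).1].
have ne m : [set wsum (fun j => xi`_j) (\poly_(j < m) 1) |
    xi in [set xi | c00star xi /\ snf_weighted hw w1 xi = 1]] !=set0.
  exists (wsum (fun j => (1 : {poly R})`_j) (\poly_(j < m) 1)), 1 => //.
  by split; [exact: c00star1|exact: snf1].
split; first by apply: ge_sup; [exact: ne|exact: ub].
set s := \sum_(j < _) _.
have s0 : 0 < s.
  rewrite /s big_ord_recl w1; apply: ltr_pwDl => //.
  by apply: sumr_ge0 => j _; exact: hw.1.
apply: sup_upper_bound; first by split; [exact: ne|exists l^-1; exact: ub].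
have si : 0 <= s^-1 by rewrite invr_ge0 ltW.
exists (\poly_(j < n.+1) s^-1).
  split; first exact: c00star_poly.
  by rewrite /= wsum_poly // -mulr_suml divff // gt_eqF.
rewrite E (eq_bigr (fun=> s^-1)); last by move=> j _; rewrite coef_poly ltn_ord.
by rewrite sumr_const card_ord mulr_natl.
Qed.

(** The weights lie between [l] and [w 0 = 1], so the two functions compare term by term with
    constants 1 and 1/l. *)
Lemma snf_weighted_equiv w (hw : weight w) (w1 : w 0%N = 1) l :
  0 < l -> (forall j, l <= w j) -> snf_equiv (snf_weighted hw w1) Phi1.
Proof.
move=> l0 lw; have w_le1 j : w j <= 1.
  by elim: j => [|j IH]; rewrite ?w1 // (le_trans (hw.2 j)).
split.
  exists 1 => _ [xi /= x0 <-].
  by rewrite ler_pdivrMr ?(snf_gt0 Phi1) // mul1r; exact: wsum_le.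
exists l^-1 => _ [xi /= x0 <-].
rewrite ler_pdivrMr ?(snf_gt0 (snf_weighted hw w1)) //.
rewrite -ler_pdivrMl ?invr_gt0 // invrK -wsum_scale.
by apply: wsum_le => j; rewrite mulr1.
Qed.

End weighted_norm.

(** * The limit of the weights and the adjoint norm of the identity *)

Section PiSet.
Variables (R : realType) (p : nat -> R).
Hypothesis hp : PiSet p.

Lemma PiSet_nonincreasing : {homo p : n m / (n <= m)%N >-> m <= n}.
Proof. by apply/nonincreasing_seqP; case: hp. Qed.

Lemma PiSet_cvg : cvgn p.
Proof.
apply: nonincreasing_is_cvgn; first exact: PiSet_nonincreasing.
by exists 0 => _ [n _ <-]; case: hp => p0 _ _ _; exact: ltW.
Qed.

Lemma PiSet_lim_le j : limn p <= p j.
Proof. exact: nonincreasing_cvgn_ge PiSet_nonincreasing PiSet_cvg j. Qed.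

Lemma PiSet_lim_gt0 : 0 < limn p. Proof. by case: hp. Qed.

Lemma PiSet_lim_lt1 : p <> (fun=> 1) -> limn p < 1.
Proof.
move=> p1; rewrite ltNge; apply/negP => l1; apply: p1; apply/funext => j.
apply/eqP; rewrite eq_le (le_trans l1 (PiSet_lim_le j)) andbT.
by rewrite -(PiSet_first hp); exact: PiSet_nonincreasing.
Qed.

Lemma opsnorm_adjoint_id_ge :
  1 <= opsnorm (adjoint (Phi_pi hp)) (idfun : l2 R -> l2 R) * limn p.
Proof.
set B := opsnorm _ _.
have hl := adjoint_weighted_cst (PiSet_weight hp) (PiSet_first hp) _
  PiSet_lim_gt0 PiSet_lim_le.
have B_ge n : n.+1%:R / (\sum_(j < n.+1) p j) <= B.
  apply: le_trans (hl n).2 _.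
  have <- : \poly_(j < n.+1) singval (idfun : l2 R -> l2 R) j =
      \poly_(j < n.+1) 1 by apply: eq_poly => j _; rewrite singval_id.
  apply: ub_le_sup; last by exists n.+1.
  (* The uniform bound makes [B] a genuine supremum, so it dominates each member. *)
  exists (limn p)^-1 => _ [m _ <-]; apply: le_trans (hl m).1.
  by under eq_poly do rewrite singval_id.
(* [B_ge] says that [B] times each mean of [p] is at least 1; Cesaro passes this to the limit. *)
have cB : (B * arithmetic_mean p n) @[n --> \oo] --> B * limn p.
  by apply: cvgMr; apply: cesaro; exact: PiSet_cvg.
rewrite -(cvg_lim _ cB) //; apply: limr_ge.
  by apply/cvg_ex; eexists; exact: cB.
apply: nearW => n; rewrite /arithmetic_mean /= seriesEord /=.
have s0 : 0 < \sum_(j < n.+1) p j.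
  rewrite big_ord_recl; apply: ltr_pwDl; first by case: hp.
  by apply: sumr_ge0 => j _; case: hp => p0 _ _ _; exact: ltW.
have := B_ge n; by rewrite ler_pdivrMr // mulrCA ler_pdivlMl ?mulr1.
Qed.

End PiSet.

(** * Equivalence, and the contradiction from a norming operator *)

Theorem theorem3p6 (R : realType) :
  (forall (p : nat -> R) (hp : PiSet p), p <> (fun=> 1) ->
     snf_equiv (Phi_pi hp) Phi1) /\
  (forall (p : nat -> R) (hp : PiSet p), p <> (fun=> 1) ->
     ~ norming (Phi_pi hp) (idfun : {linear l2 R -> l2 R})).
Proof.
split=> p hp p1.
  exact: snf_weighted_equiv (PiSet_lim_gt0 hp) (PiSet_lim_le hp).
move=> [_ [K [[bK _] K1 trK]]].
(* Attainment turns the lower bound on the adjoint norm into [1 <= t * l] with [t] the modulus of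
   the trace of [K]. *)
have := opsnorm_adjoint_id_ge hp; rewrite -trK /=; set t := modulus _.
have l0 := PiSet_lim_gt0 hp; have l1 := PiSet_lim_lt1 hp p1.
have lp := PiSet_lim_le hp; set l := limn p in l0 l1 lp * => tl.
pose s := singval K.
have s0 j : 0 <= s j by exact: singval_ge0.
have sS j : s j.+1 <= s j by exact: singvalS_le.
have hs : has_sup (range (fun n => Phi_pi hp (\poly_(j < n) s j))).
  (* Without a supremum the norm of [K] would be the default 0 instead of 1. *)
  apply: contrapT => /sup_out h.
  by move: K1; rewrite /opsnorm h => /eqP; rewrite eq_sym oner_eq0.
have ps n : \sum_(j < n) p j * s j <= 1.
  rewrite -K1 -wsum_poly //; by apply: (sup_upper_bound hs); exists n.
have t_le b : 0 <= b -> (forall n, \sum_(j < n) s j <= b) -> t <= b.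
  move=> b0 hb; apply: modulus_trace_le => // n.
  exact: le_trans (partial_trace_le n bK) (hb n).
clearbody s t l; clear hs K1 trK.
(* Splitting the first weight as 1 = l + (1 - l) and bounding the others below by [l] yields this
   bound. *)
pose b := (1 - (1 - l) * s 0%N) / l.
have sb n : \sum_(j < n.+1) s j <= b.
  have h : \sum_(i < n) s (lift ord0 i) * l <=
      \sum_(i < n) p (lift ord0 i) * s (lift ord0 i).
    by apply: ler_sum => j _; rewrite mulrC ler_wpM2r.
  rewrite /b ler_pdivlMr //; have := ps n.+1.
  rewrite !big_ord_recl (PiSet_first hp) mul1r mulrDl mulr_suml.
  move: h; set x := \sum_(i < n) _; set y := \sum_(i < n) _.
  rewrite /=; lra.
have tb : t <= b.
  have b0 : 0 <= b by apply: le_trans (sb 0%N); exact: sumr_ge0.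
  by apply: t_le => // -[|n]; [rewrite big_ord0|exact: sb].
(* [1 <= t * l] and [t <= b] force [(1 - l) * s 0 <= 0], while [l < 1]. All of [s] then vanishes, so
   [t <= 0], which is absurd. *)
have s00 : s 0%N = 0.
  move: tb; rewrite /b ler_pdivlMr // => tb.
  have := s0 0%N; nra.
have sj0 j : s j = 0.
  apply/eqP; rewrite eq_le s0 andbT.
  by elim: j => [|j IH]; [rewrite s00|exact: le_trans (sS j) IH].
have : t <= 0 by apply: t_le => // n; rewrite big1.
nra.
Qed.
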